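(* Suppose $(U,S)$ is a weak action pair in a monoid $M$, with $U$ and $S$ both submonoids of $M$, and with $S$ acting on $U(=U^1)$ by monoid morphisms. Let $\theta=\{((u,s),(v,t)):u,v\in U,\ s,t\in S,\ us=vt\}$, which is a congruence on the semidirect product $U\rtimes S$, and suppose $\theta=\Omega^\sharp$ is the congruence generated by a set of pairs $\Omega\subseteq(U\rtimes S)\times(U\rtimes S)$. Then, with $X_U,R_U,X_S,R_S,N_U,N_S$ as in the context, the monoid $US$ has presentation $$\operatorname{Mon}\langle X_U\cup X_S : R_U\cup R_S\cup R_1\cup R_\Omega\rangle$$ via the morphism $\Phi:(X_U\cup X_S)^*\to US$ determined by $x\mapsto x\phi_U$ for $x\in X_U$ and $x\mapsto x\phi_S$ for $x\in X_S$, where $$R_1=\{(xy,\,{}^xy\cdot x):x\in X_S,\ y\in X_U\},\qquad R_\Omega=\{(N(\mathbf a),N(\mathbf b)):(\mathbf a,\mathbf b)\in\Omega\},$$ ${}^xy=N_U({}^{\overline x}\,\overline y)\in X_U^*$, and $N(u,s)=N_U(u)N_S(s)$ for $(u,s)\in U\rtimes S$.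
   Context: Weak action pairs. For a monoid $M$ with identity $1$ and a subsemigroup $U$, $U^1=U\cup\{1\}$. A weak action pair in $M$ is a pair $(U,S)$ of subsemigroups of $M$ with a left action $(s,u)\mapsto{}^su$ of $S$ on $U^1$ by semigroup morphisms (${}^s({}^tu)={}^{st}u$ and ${}^s(uv)={}^su\cdot{}^sv$) such that $s\cdot u={}^su\cdot s$ for all $s\in S$, $u\in U^1$. The action is by monoid morphisms if also ${}^s1=1$ for all $s\in S$. $US=\{us:u\in U,s\in S\}$. $U\rtimes S$ is the set $U\times S$ with product $(u,s)(v,t)=(u\cdot{}^sv,st)$. Presentations. $X^*$ is the free monoid on $X$, with empty word $\iota$; for $R\subseteq X^*\times X^*$, $R^\sharp$ is the congruence generated by $R$. A monoid $T$ has presentation $\operatorname{Mon}\langle X:R\rangle$ via $\phi$ if $\phi:X^*\to T$ is a surjective monoid morphism with kernel $R^\sharp$. A normal form function is a map $N:T\to X^*$ with $N(t)\phi=t$ for all $t\in T$. Maps are written on the right. Fixed data. $U$ has presentation $\operatorname{Mon}\langle X_U:R_U\rangle$ via $\phi_U:X_U^*\to U$, and $S$ has presentation $\operatorname{Mon}\langle X_S:R_S\rangle$ via $\phi_S:X_S^*\to S$, where $X_U\cap X_S=\varnothing$, no letter of $X_U$ or $X_S$ maps to $1$, and $\phi_U|_{X_U}$, $\phi_S|_{X_S}$ are injective. Write $\overline w=w\phi_U$ for $w\in X_U^*$ and $\overline w=w\phi_S$ for $w\in X_S^*$. $N_U:U\to X_U^*$ and $N_S:S\to X_S^*$ are fixed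 normal form functions with $N_U(1)=N_S(1)=\iota$, $N_U(\overline x)=x$ for $x\in X_U$, and $N_S(\overline y)=y$ for $y\in X_S$. *)

(* Defs.v *)
From mathcomp Require Import all_boot.
From mathcomp Require Import classical_sets.

Set Implicit Arguments.
Unset Strict Implicit.
Unset Printing Implicit Defensive.

Local Open Scope classical_set_scope.
Local Open Scope group_scope.

(* A semigroup is given here by a carrier [A : set T] and an operation [op] on
   the ambient type [T], of which only the restriction to [A] matters. *)
Record congruence (T : Type) (A : set T) (op : T -> T -> T)
    (K : set (T * T)) : Prop := Congruence {
  congruence_sub : K `<=` A `*` A;
  congruence_refl : forall a, A a -> K (a, a);
  congruence_sym : forall a b, K (a, b) -> K (b, a);
  congruence_trans : forall a b c, K (a, b) -> K (b, c) -> K (a, c);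
  congruence_op : forall a b c d,
    K (a, b) -> K (c, d) -> K (op a c, op b d) }.

(* R^sharp *)
Definition generated_congruence (T : Type) (A : set T) (op : T -> T -> T)
    (R : set (T * T)) : set (T * T) :=
  smallest (congruence A op) R.

(* The free monoid on [X] is [seq X] with concatenation. *)
Definition word_congruence (X : Type) (R : set (seq X * seq X)) :
    set (seq X * seq X) :=
  generated_congruence [set: seq X] cat R.

Definition word_morphism (X : Type) (M : monoidType) (phi : seq X -> M) : Prop :=
  phi [::] = 1 /\ forall v w, phi (v ++ w) = phi v * phi w.

Definition kernel (A B : Type) (f : A -> B) : set (A * A) :=
  [set p | f p.1 = f p.2].

(* The submonoid [T] of [M] has presentation Mon<X : R> via [phi]; that [T] is
   a submonoid follows from its being the image of a monoid morphism. *)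
Record has_presentation (M : monoidType) (T : set M) (X : Type)
    (R : set (seq X * seq X)) (phi : seq X -> M) : Prop := HasPresentation {
  presentation_morphism : word_morphism phi;
  presentation_image : range phi = T;
  presentation_kernel : kernel phi = word_congruence R }.

(* The morphism on words determined by its values on letters. *)
Definition word_lift (X : Type) (M : monoidType) (f : X -> M) (w : seq X) : M :=
  \prod_(x <- w) f x.

Section WeakActionPairs.
Variable M : monoidType.
Implicit Types (U S : set M) (act : M -> M -> M).

Definition subsemigroup U : Prop := forall u v, U u -> U v -> U (u * v).

Definition submonoid U : Prop := U 1 /\ subsemigroup U.

Definition adjoin_one U : set M := U `|` [set 1].

(* [act s u] is the left action of s on u; only its values for s in S and u in
   U^1 are constrained. *)
Record weak_action_pair U S act : Prop := WeakActionPair {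
  wap_subU : subsemigroup U;
  wap_subS : subsemigroup S;
  wap_act : forall s u, S s -> adjoin_one U u -> adjoin_one U (act s u);
  wap_actA : forall s t u, S s -> S t -> adjoin_one U u ->
    act s (act t u) = act (s * t) u;
  wap_actM : forall s u v, S s -> adjoin_one U u -> adjoin_one U v ->
    act s (u * v) = act s u * act s v;
  wap_comm : forall s u, S s -> adjoin_one U u -> s * u = act s u * s }.

Definition acts_by_monoid_morphisms S act : Prop :=
  forall s, S s -> act s 1 = 1.

Definition set_product U S : set M := [set u * s | u in U & s in S].

(* The product of the semidirect product of U and S, whose carrier is the set
   [U `*` S]. *)
Definition semidirect_mul act (a b : M * M) : M * M :=
  (a.1 * act a.2 b.1, a.2 * b.2).

Definition semidirect_congruence U S act (Omega : set ((M * M) * (M * M))) :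
    set ((M * M) * (M * M)) :=
  generated_congruence (U `*` S) (semidirect_mul act) Omega.

Definition theta U S : set ((M * M) * (M * M)) :=
  [set p | [/\ (U `*` S) p.1, (U `*` S) p.2 & p.1.1 * p.1.2 = p.2.1 * p.2.2]].

Lemma adjoin_oneP U u : U u -> adjoin_one U u.
Proof. by move=> Uu; left. Qed.

Lemma semidirect_mul_closed U S act a b : weak_action_pair U S act ->
  (U `*` S) a -> (U `*` S) b -> (U `*` S) (semidirect_mul act a b).
Proof.
move=> W [Ua Sa] [Ub Sb]; split; last exact: (wap_subS W).
have [Uab|/= ->] := wap_act W Sa (adjoin_oneP Ub).
  exact: (wap_subU W).
by rewrite /= mulg1.
Qed.

Lemma semidirect_mulA U S act a b c : weak_action_pair U S act ->
  (U `*` S) a -> (U `*` S) b -> (U `*` S) c ->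
  semidirect_mul act a (semidirect_mul act b c) =
  semidirect_mul act (semidirect_mul act a b) c.
Proof.
move=> W [_ Sa] [Ub Sb] [Uc Sc].
rewrite /semidirect_mul /= (wap_actM W) ?(wap_actA W) ?mulgA //;
  try exact: adjoin_oneP.
by apply: (wap_act W) => //; exact: adjoin_oneP.
Qed.

Lemma theta_congruence U S act : weak_action_pair U S act ->
  congruence (U `*` S) (semidirect_mul act) (theta U S).
Proof.
move=> W; split=> [p [] //|a|a b []|a b c [? ? /= ab] [? ? /= bc]|].
- by split.
- by split.
- by split=> //=; rewrite ab.
move=> a b c d [Ha Hb /= ab] [Hc Hd /= cd].
split; [exact: semidirect_mul_closed|exact: semidirect_mul_closed|].
have swap x y : (U `*` S) x -> (U `*` S) y ->
    x.1 * act x.2 y.1 * (x.2 * y.2) = x.1 * x.2 * (y.1 * y.2).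
  move=> [_ Sx] [Uy _]; rewrite -!mulgA; congr (_ * _).
  by rewrite !mulgA (wap_comm W Sx (adjoin_oneP Uy)).
by rewrite /= !swap // ab cd.
Qed.

End WeakActionPairs.

(* Presentation data for a submonoid [T] of [M]: a presentation with injective,
   nontrivial letters, and a normal form function [N] that fixes the empty word
   and the letters. Only the values of [N] on [T] matter. *)
Record presentation_data (M : monoidType) (T : set M) (X : Type)
    (R : set (seq X * seq X)) (phi : seq X -> M) (N : M -> seq X) : Prop :=
  PresentationData {
    pd_presentation : has_presentation T R phi;
    pd_letter_neq1 : forall x, phi [:: x] <> 1;
    pd_letter_inj : forall x y, phi [:: x] = phi [:: y] -> x = y;
    pd_normal_form : forall t, T t -> phi (N t) = t;
    pd_normal_form1 : N 1 = [::];
    pd_normal_form_letter : forall x, N (phi [:: x]) = [:: x] }.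

(* The disjoint union of the alphabets X_U and X_S is the sum type [XU + XS]. *)
Section Relations.
Variables (M : monoidType) (XU XS : Type).
Variables (phiU : seq XU -> M) (phiS : seq XS -> M).
Variables (NU : M -> seq XU) (NS : M -> seq XS) (act : M -> M -> M).

Definition in_U (w : seq XU) : seq (XU + XS) := map inl w.
Definition in_S (w : seq XS) : seq (XU + XS) := map inr w.

Definition rels_U (R : set (seq XU * seq XU)) :
    set (seq (XU + XS) * seq (XU + XS)) :=
  [set (in_U p.1, in_U p.2) | p in R].

Definition rels_S (R : set (seq XS * seq XS)) :
    set (seq (XU + XS) * seq (XU + XS)) :=
  [set (in_S p.1, in_S p.2) | p in R].

Definition letter_act (x : XS) (y : XU) : seq XU :=
  NU (act (phiS [:: x]) (phiU [:: y])).

Definition rels_1 : set (seq (XU + XS) * seq (XU + XS)) :=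
  [set p | exists x y,
    p = (in_S [:: x] ++ in_U [:: y], in_U (letter_act x y) ++ in_S [:: x])].

Definition pair_normal_form (a : M * M) : seq (XU + XS) :=
  in_U (NU a.1) ++ in_S (NS a.2).

Definition rels_Omega (Omega : set ((M * M) * (M * M))) :
    set (seq (XU + XS) * seq (XU + XS)) :=
  [set (pair_normal_form p.1, pair_normal_form p.2) | p in Omega].

Definition Phi : seq (XU + XS) -> M :=
  word_lift (fun z : XU + XS =>
    match z with inl x => phiU [:: x] | inr y => phiS [:: y] end).

End Relations.

(* Main.v *)
Require Import Defs.
From mathcomp Require Import all_boot.
From mathcomp Require Import classical_sets.

(** The relations hold in [US], so the point is that they suffice. Write [~] for
    the word congruence that they generate, and [N(u,s)] for [N_U(u) N_S(s)].

    The relations [xy ~ (^x y) x] of [R_1] push letters of [X_S] to the right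
    past letters of [X_U]; since the action is by monoid morphisms, they extend
    to [s u ~ N_U(^s u) s] for arbitrary words ([in_S_in_U_swap]). As [R_U] and
    [R_S] identify any two words over one alphabet with the same value, it
    follows that [N] is multiplicative up to [~] ([pair_normal_form_mul]) and
    that each word [w] is [~]-related to some [N(a)], where the two components
    of [a] multiply to the value of [w] ([word_normal_form]).

    In other words, modulo [~] the map [N] is a surjective morphism from the
    semidirect product. Its kernel is a congruence that contains [Omega], by
    [R_Omega], hence contains [theta], the congruence generated by [Omega]
    ([semidirect_congruence_normal_form]). If now two words have equal value in
    [US], then their pairs [a] and [b] are [theta]-related, so [N(a) ~ N(b)],
    and the words are [~]-related. *)

Set Implicit Arguments.
Unset Strict Implicit.
Unset Printing Implicit Defensive.

Local Open Scope classical_set_scope.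

(** * Word congruences and word morphisms *)

Lemma word_congruence_congruence (X : Type) (R : set (seq X * seq X)) :
  congruence [set: seq X] cat (word_congruence R).
Proof.
split=> [//|a _|a b ab|a b c ab bc|a b c d ab cd] K [Kcong RK].
- exact: (congruence_refl Kcong).
- by apply: (congruence_sym Kcong); exact: ab.
- by apply: (congruence_trans Kcong (b := b)); [exact: ab|exact: bc].
- by apply: (congruence_op Kcong); [exact: ab|exact: cd].
Qed.

Section WordCongruence.
Variables (X : Type) (R : set (seq X * seq X)).
Local Notation "v ~ w" := (word_congruence R (v, w)) (at level 70).

Lemma word_congruence_rel v w : R (v, w) -> v ~ w.
Proof. by move=> Rvw K [_]; exact. Qed.

Lemma word_congruence_refl w : w ~ w.
Proof. exact: (congruence_refl (word_congruence_congruence R)). Qed.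

Lemma word_congruence_sym v w : v ~ w -> w ~ v.
Proof. exact: (congruence_sym (word_congruence_congruence R)). Qed.

Lemma word_congruence_trans w v u : v ~ w -> w ~ u -> v ~ u.
Proof. exact: (congruence_trans (word_congruence_congruence R)). Qed.

Lemma word_congruence_cat v v' w w' : v ~ v' -> w ~ w' -> v ++ w ~ v' ++ w'.
Proof. exact: (congruence_op (word_congruence_congruence R)). Qed.

Lemma word_congruence_catl u v w : v ~ w -> u ++ v ~ u ++ w.
Proof. by apply: word_congruence_cat; exact: word_congruence_refl. Qed.

Lemma word_congruence_catr u v w : v ~ w -> v ++ u ~ w ++ u.
Proof.
by move=> vw; apply: word_congruence_cat => //; exact: word_congruence_refl.
Qed.

End WordCongruence.

(** Renaming letters carries one word congruence into another as soon as it does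
    so on generators: the pairs with related images form a congruence. *)
Lemma word_congruence_map (X Y : Type) (f : X -> Y)
    (R : set (seq X * seq X)) (Q : set (seq Y * seq Y)) :
  (forall v w, R (v, w) -> word_congruence Q (map f v, map f w)) ->
  forall v w, word_congruence R (v, w) ->
    word_congruence Q (map f v, map f w).
Proof.
move=> RQ v w /(_ [set p | word_congruence Q (map f p.1, map f p.2)]); apply.
split=> [|[v' w'] /RQ //]; split=> [//|a _|a b|a b c|a b c d] /=.
- exact: word_congruence_refl.
- exact: word_congruence_sym.
- exact: word_congruence_trans.
- by rewrite !map_cat; exact: word_congruence_cat.
Qed.

Section WordMorphism.
Local Open Scope group_scope.
Variables (M : monoidType) (X : Type).
Implicit Types (phi : seq X -> M) (f : X -> M).

Lemma kernel_congruence phi :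
  word_morphism phi -> congruence [set: seq X] cat (kernel phi).
Proof.
case=> _ phiM; split; rewrite /kernel //=.
- by move=> a b c ->.
- by move=> a b c d; rewrite !phiM => -> ->.
Qed.

Lemma word_congruence_sub_kernel (R : set (seq X * seq X)) phi :
  word_morphism phi -> R `<=` kernel phi -> word_congruence R `<=` kernel phi.
Proof. by move=> /kernel_congruence cphi Rphi p; apply. Qed.

Lemma word_lift_morphism f : word_morphism (word_lift f).
Proof.
by rewrite /word_lift; split=> [|v w]; rewrite ?big_nil ?big_cat.
Qed.

Lemma word_lift_letter f x : word_lift f [:: x] = f x.
Proof. exact: big_seq1. Qed.

End WordMorphism.

Section Presentation.
Variables (M : monoidType) (T : set M) (X : Type).
Variables (R : set (seq X * seq X)) (phi : seq X -> M) (N : M -> seq X).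
Hypothesis hdata : presentation_data T R phi N.
Local Open Scope group_scope.

Let hpres := pd_presentation hdata.

Lemma presentation_value1 : phi [::] = 1.
Proof. by have [] := presentation_morphism hpres. Qed.

Lemma presentation_valueM v w : phi (v ++ w) = phi v * phi w.
Proof. by have [_] := presentation_morphism hpres; apply. Qed.

Lemma presentation_value_in w : T (phi w).
Proof. by rewrite -(presentation_image hpres); exists w. Qed.

Lemma presentation_value_inj v w :
  phi v = phi w -> word_congruence R (v, w).
Proof. by move=> vw; rewrite -(presentation_kernel hpres). Qed.

Lemma presentation_rel v w : R (v, w) -> phi v = phi w.
Proof.
move=> /word_congruence_rel; rewrite -(presentation_kernel hpres).
exact.
Qed.

End Presentation.

(** * Normal forms in the product of a weak action pair *)

Section WeakActionPairPresentation.
Variables (M : monoidType) (U S : set M) (act : M -> M -> M).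
Variables (XU XS : Type).
Variables (RU : set (seq XU * seq XU)) (RS : set (seq XS * seq XS)).
Variables (phiU : seq XU -> M) (phiS : seq XS -> M).
Variables (NU : M -> seq XU) (NS : M -> seq XS).
Variable Omega : set ((M * M) * (M * M)).
Hypothesis hUS : weak_action_pair U S act.
Hypotheses (hU : submonoid U) (hS : submonoid S).
Hypothesis hact : acts_by_monoid_morphisms S act.
Hypothesis hdataU : presentation_data U RU phiU NU.
Hypothesis hdataS : presentation_data S RS phiS NS.

Local Open Scope group_scope.

Notation relations := (rels_U RU `|` rels_S RS `|` rels_1 phiU phiS NU act
  `|` rels_Omega NU NS Omega).
Notation "v ~ w" := (word_congruence relations (v, w)) (at level 70).
Notation iU := (@in_U XU XS).
Notation iS := (@in_S XU XS).
Notation N := (pair_normal_form NU NS).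
Notation Phi := (Phi phiU phiS).

Lemma in_U_cat v w : iU (v ++ w) = iU v ++ iU w.
Proof. exact: map_cat. Qed.

Lemma in_S_cat v w : iS (v ++ w) = iS v ++ iS w.
Proof. exact: map_cat. Qed.

Lemma act_closed s u : S s -> U u -> U (act s u).
Proof.
move=> Ss Uu; have [//|->] := wap_act hUS Ss (adjoin_oneP Uu).
by case: hU.
Qed.

(** This comes from the commutation rule [s * u = act s u * s] at [s = 1]. *)
Lemma act_one u : U u -> act 1 u = u.
Proof.
move=> Uu; have /= := wap_comm hUS hS.1 (adjoin_oneP Uu).
by rewrite mulg1 mul1g.
Qed.

Lemma in_U_congruence v w : phiU v = phiU w -> iU v ~ iU w.
Proof.
move/(presentation_value_inj hdataU); apply: word_congruence_map => {}v {}w Rvw.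
by apply: word_congruence_rel; do 3 left; exists (v, w).
Qed.

Lemma in_S_congruence v w : phiS v = phiS w -> iS v ~ iS w.
Proof.
move/(presentation_value_inj hdataS); apply: word_congruence_map => {}v {}w Rvw.
by apply: word_congruence_rel; do 2 left; right; exists (v, w).
Qed.

(** The letter moves past [u] one letter at a time by [rels_1]; each passage
    leaves a normal form behind, and the relations of [U] merge these because
    the letter acts by a morphism. The empty word needs [act s 1 = 1]. *)
Lemma in_S_letter_in_U_swap x u :
  iS [:: x] ++ iU u ~ iU (NU (act (phiS [:: x]) (phiU u))) ++ iS [:: x].
Proof.
have Sx := presentation_value_in hdataS [:: x].
have Uin := presentation_value_in hdataU.
elim: u => [|y u IHu].
  rewrite (presentation_value1 hdataU) (hact Sx) (pd_normal_form1 hdataU).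
  exact: word_congruence_refl.
apply: (@word_congruence_trans _ _
  (iU (letter_act phiU phiS NU act x y) ++ iS [:: x] ++ iU u)).
  rewrite -(cat1s y u) in_U_cat !catA; apply: word_congruence_catr.
  by apply: word_congruence_rel; left; right; exists x, y.
apply: word_congruence_trans (word_congruence_catl _ IHu) _.
rewrite catA -in_U_cat; apply: word_congruence_catr; apply: in_U_congruence.
have UN v : phiU (NU (act (phiS [:: x]) (phiU v))) = act (phiS [:: x]) (phiU v).
  by apply: (pd_normal_form hdataU); exact: act_closed.
rewrite (presentation_valueM hdataU) /letter_act !UN -(cat1s y u).
by rewrite (presentation_valueM hdataU) (wap_actM hUS) //; exact: adjoin_oneP.
Qed.

Lemma in_S_in_U_swap s u :
  iS s ++ iU u ~ iU (NU (act (phiS s) (phiU u))) ++ iS s.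
Proof.
have Uin := presentation_value_in hdataU.
have Sin := presentation_value_in hdataS.
elim: s => [|x s IHs].
  rewrite (presentation_value1 hdataS) act_one // cats0; apply: in_U_congruence.
  by rewrite (pd_normal_form hdataU).
have UN : phiU (NU (act (phiS s) (phiU u))) = act (phiS s) (phiU u).
  by apply: (pd_normal_form hdataU); exact: act_closed.
rewrite -(cat1s x s) in_S_cat -catA.
apply: word_congruence_trans (word_congruence_catl _ IHs) _.
rewrite !catA; apply: word_congruence_catr.
apply: word_congruence_trans (in_S_letter_in_U_swap _ _) _.
rewrite UN (wap_actA hUS) //; last exact: adjoin_oneP.
rewrite (presentation_valueM hdataS); exact: word_congruence_refl.
Qed.

(** Swapping the two middle factors of [N_U(a.1) N_S(a.2) N_U(b.1) N_S(b.2)]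
    leaves a word over [X_U] followed by a word over [X_S], and the values of
    these two words are the components of the semidirect product. *)
Lemma pair_normal_form_mul a b : (U `*` S) a -> (U `*` S) b ->
  N a ++ N b ~ N (semidirect_mul act a b).
Proof.
move=> [Ua Sa] [Ub Sb].
have [Uab Sab] := semidirect_mul_closed hUS (conj Ua Sa) (conj Ub Sb).
rewrite /pair_normal_form -catA.
apply: (@word_congruence_trans _ _ (iU (NU a.1) ++
    (iU (NU (act a.2 b.1)) ++ iS (NS a.2)) ++ iS (NS b.2))).
  apply: word_congruence_catl; rewrite catA; apply: word_congruence_catr.
  have := in_S_in_U_swap (NS a.2) (NU b.1).
  by rewrite (pd_normal_form hdataS) // (pd_normal_form hdataU).
rewrite -catA catA -in_U_cat -in_S_cat.
apply: word_congruence_cat.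
- apply: in_U_congruence; rewrite (presentation_valueM hdataU).
  rewrite !(pd_normal_form hdataU) //; exact: act_closed.
- apply: in_S_congruence; rewrite (presentation_valueM hdataS).
  by rewrite !(pd_normal_form hdataS).
Qed.

Lemma letter_normal_form (z : XU + XS) :
  exists2 a, (U `*` S) a & [:: z] ~ N a /\ Phi [:: z] = a.1 * a.2.
Proof.
rewrite /Defs.Phi word_lift_letter /pair_normal_form; case: z => [x|y].
- exists (phiU [:: x], 1).
    by split=> /=; [exact: (presentation_value_in hdataU)|case: hS].
  rewrite /= mulg1 (pd_normal_form1 hdataS) (pd_normal_form_letter hdataU).
  by split=> //; exact: word_congruence_refl.
- exists (1, phiS [:: y]).
    by split=> /=; [case: hU|exact: (presentation_value_in hdataS)].
  rewrite /= mul1g (pd_normal_form1 hdataU) (pd_normal_form_letter hdataS).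
  by split=> //; exact: word_congruence_refl.
Qed.

Lemma semidirect_mul_value a b : (U `*` S) a -> (U `*` S) b ->
  (semidirect_mul act a b).1 * (semidirect_mul act a b).2 =
  a.1 * a.2 * (b.1 * b.2).
Proof.
move=> [_ Sa] [Ub _]; rewrite /= -!mulgA; congr (_ * _).
by rewrite !mulgA (wap_comm hUS Sa (adjoin_oneP Ub)).
Qed.

Lemma word_normal_form w :
  exists2 a, (U `*` S) a & w ~ N a /\ Phi w = a.1 * a.2.
Proof.
have [Phi1 PhiM] : word_morphism Phi by exact: word_lift_morphism.
elim: w => [|z w [b USb [wb Phib]]].
  exists (1, 1); first by split; [case: hU|case: hS].
  rewrite /pair_normal_form /= (pd_normal_form1 hdataU) (pd_normal_form1 hdataS).
  by rewrite Phi1 mulg1; split=> //; exact: word_congruence_refl.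
have [a USa [za Phia]] := letter_normal_form z.
exists (semidirect_mul act a b); first exact: (semidirect_mul_closed hUS).
rewrite semidirect_mul_value // -cat1s PhiM Phia Phib; split=> //.
apply: word_congruence_trans (word_congruence_cat za wb) _.
exact: pair_normal_form_mul.
Qed.

(** By multiplicativity of [N], the pairs with congruent normal forms are a
    congruence on the semidirect product, and [rels_Omega] puts [Omega] in it. *)
Lemma semidirect_congruence_normal_form a b :
  Omega `<=` (U `*` S) `*` (U `*` S) ->
  semidirect_congruence U S act Omega (a, b) -> N a ~ N b.
Proof.
move=> hOmega ab.
suff: ((U `*` S) `*` (U `*` S) `&` [set p | N p.1 ~ N p.2]) (a, b) by case.
apply: ab; split; last first.
  move=> p Op; split; first exact: hOmega.
  by apply: word_congruence_rel; right; exists p.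
split=> [p []//|c USc|c d [[USc USd] cd]|c d e [[USc _] cd] [[_ USe] de]|].
- by split=> //; exact: word_congruence_refl.
- by split=> //; exact: word_congruence_sym.
- by split=> //; exact: word_congruence_trans cd de.
move=> c d e f [[/= USc USd] cd] [[/= USe USf] ef].
split; first by split; exact: (semidirect_mul_closed hUS).
apply: (word_congruence_trans _ (pair_normal_form_mul USd USf)).
apply: word_congruence_trans (word_congruence_cat cd ef).
by apply: word_congruence_sym; exact: pair_normal_form_mul.
Qed.

Lemma Phi_in_U u : Phi (iU u) = phiU u.
Proof.
have [Phi1 PhiM] : word_morphism Phi by exact: word_lift_morphism.
elim: u => [|x u IHu]; first by rewrite Phi1 (presentation_value1 hdataU).
rewrite -(cat1s x u) in_U_cat PhiM IHu (presentation_valueM hdataU).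
by rewrite /Defs.Phi word_lift_letter.
Qed.

Lemma Phi_in_S s : Phi (iS s) = phiS s.
Proof.
have [Phi1 PhiM] : word_morphism Phi by exact: word_lift_morphism.
elim: s => [|x s IHs]; first by rewrite Phi1 (presentation_value1 hdataS).
rewrite -(cat1s x s) in_S_cat PhiM IHs (presentation_valueM hdataS).
by rewrite /Defs.Phi word_lift_letter.
Qed.

Lemma Phi_pair_normal_form a : (U `*` S) a -> Phi (N a) = a.1 * a.2.
Proof.
have [_ PhiM] : word_morphism Phi by exact: word_lift_morphism.
move=> [Ua Sa]; rewrite /pair_normal_form PhiM Phi_in_U Phi_in_S.
by rewrite (pd_normal_form hdataU) // (pd_normal_form hdataS).
Qed.

Lemma relations_sub_kernel : Omega `<=` theta U S -> relations `<=` kernel Phi.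
Proof.
have [_ PhiM] : word_morphism Phi by exact: word_lift_morphism.
move=> hOmega _ [[[[[v w] Rvw <-]|[[v w] Rvw <-]]|[x [y ->]]]|[[a b] Oab <-]].
- by rewrite /kernel /= !Phi_in_U; exact: (presentation_rel hdataU).
- by rewrite /kernel /= !Phi_in_S; exact: (presentation_rel hdataS).
- have Sx := presentation_value_in hdataS [:: x].
  have Uy := presentation_value_in hdataU [:: y].
  change (Phi (iS [:: x] ++ iU [:: y]) =
          Phi (iU (letter_act phiU phiS NU act x y) ++ iS [:: x])).
  rewrite !PhiM !Phi_in_U !Phi_in_S (wap_comm hUS Sx (adjoin_oneP Uy)).
  by rewrite /letter_act (pd_normal_form hdataU) //; exact: act_closed.
- by have [? ? ?] := hOmega _ Oab; rewrite /kernel /= !Phi_pair_normal_form.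
Qed.

End WeakActionPairPresentation.

Theorem theorem6p5 (M : monoidType) (U S : set M) (act : M -> M -> M)
    (XU XS : Type) (RU : set (seq XU * seq XU)) (RS : set (seq XS * seq XS))
    (phiU : seq XU -> M) (phiS : seq XS -> M)
    (NU : M -> seq XU) (NS : M -> seq XS)
    (Omega : set ((M * M) * (M * M)))
    (hUS : weak_action_pair U S act)
    (hU : submonoid U) (hS : submonoid S)
    (hact : acts_by_monoid_morphisms S act)
    (hdataU : presentation_data U RU phiU NU)
    (hdataS : presentation_data S RS phiS NS)
    (hOmega : Omega `<=` (U `*` S) `*` (U `*` S))
    (htheta : theta U S = semidirect_congruence U S act Omega) :
  has_presentation (set_product U S)
    (rels_U RU `|` rels_S RS `|` rels_1 phiU phiS NU act
       `|` rels_Omega NU NS Omega)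
    (Phi phiU phiS).
Proof.
have normal_form := word_normal_form Omega hUS hU hS hact hdataU hdataS.
have Phi_morphism : word_morphism (Phi phiU phiS) by exact: word_lift_morphism.
split=> //.
- apply/seteqP; split=> [_ [w _ <-]|_ [u Uu [s Ss <-]]].
    have [[u s] [Uu Ss] [_ ->]] := normal_form w.
    by exists u => //; exists s.
  exists (pair_normal_form NU NS (u, s)) => //.
  by rewrite (Phi_pair_normal_form hdataU hdataS).
- apply/seteqP; split=> [[v w] /= Phi_vw|].
    have [a USa [va Phi_v]] := normal_form v.
    have [b USb [wb Phi_w]] := normal_form w.
    have ab : theta U S (a, b).
      by split=> //=; rewrite -Phi_v -Phi_w; exact: Phi_vw.
    apply: word_congruence_trans va _.
    apply: (word_congruence_trans _ (word_congruence_sym wb)).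
    apply: (semidirect_congruence_normal_form hUS) => //.
    by rewrite -htheta.
  apply: word_congruence_sub_kernel => //.
  apply: (relations_sub_kernel hUS hU hdataU hdataS).
  by rewrite htheta => p Op K [_]; exact.
Qed.
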